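(* If $h(x_1,\dots,x_t)$ is a tree polynomial, i.e. its graphical representation is a tree or a forest ($t$ constant), then for any $Q^{(1)},\dots,Q^{(t)},V^{(2)},\dots,V^{(t)}\in\mathbb{R}^{n\times d}$ with $d=O(\log n)$, the matrix $\mathrm{Att}^{(h)}$ can be computed exactly in time $\tilde O(n^2)$.
   Context: An attention polynomial is a multilinear polynomial with coefficients in $\{0,1\}$ all of whose monomials have degree at least $2$. For an attention polynomial $h(x_1,\dots,x_t)$ of degree $2$, its graphical representation is the simple graph on vertices $v_1,\dots,v_t$ with an edge $v_iv_j$ iff $x_ix_j$ is a monomial of $h$, and $h(Y_1,\dots,Y_t)=\sum_{x_ix_j\text{ a monomial of }h}\langle Y_i,Y_j\rangle$ for $Y_1,\dots,Y_t\in\mathbb{R}^d$. $\mathrm{Att}^{(h)}\in\mathbb{R}^{n\times d}$ is the matrix with rows $$\mathrm{Att}^{(h)}_{\ell_1}=\frac{\sum_{\ell_2,\dots,\ell_t\in[n]}\exp\big(\tfrac1d h(Q^{(1)}_{\ell_1},\dots,Q^{(t)}_{\ell_t})\big)\,V^{(2)}_{\ell_2}\odot\cdots\odot V^{(t)}_{\ell_t}}{\sum_{\ell_2,\dots,\ell_t\in[n]}\exp\big(\tfrac1d h(Q^{(1)}_{\ell_1},\dots,Q^{(t)}_{\ell_t})\big)},$$ where subscripts denote rows and $\odot$ is the entrywise product. $\tilde O$ hides factors polylogarithmic in $n$; running times count arithmetic operations, including exponentials. *)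

(* Defs.v *)
From HB Require Import structures.
From mathcomp Require Import all_boot all_order all_algebra.
From mathcomp Require Import mpoly.
From mathcomp Require Import reals sequences exp.

Set Implicit Arguments.
Unset Strict Implicit.
Unset Printing Implicit Defensive.

Import Order.TTheory GRing.Theory Num.Theory.
Local Open Scope ring_scope.

Definition attention_poly (t : nat) (h : {mpoly int[t]}) : Prop :=
  [/\ forall m, h@_m = 0 \/ h@_m = 1,
      forall m, m \in msupp h -> forall i, (m i <= 1)%N
    & forall m, m \in msupp h -> (2 <= mdeg m)%N].

(* Total degree d, as msize is one more than the degree. *)
Definition has_degree (t : nat) (h : {mpoly int[t]}) (d : nat) : Prop :=
  msize h = d.+1.

Definition graph_of (t : nat) (h : {mpoly int[t]}) : rel 'I_t :=
  fun i j => (i != j) && ((U_(i) + U_(j))%MM \in msupp h).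

(* For a symmetric irreflexive e.  The length bound is needed because every
   edge i j yields the closed walk [:: i; j]. *)
Definition acyclic (T : eqType) (e : rel T) : Prop :=
  forall c : seq T, (2 < size c)%N -> ~ ucycle e c.

(* A tree is in particular a forest, so "tree or forest" is acyclicity. *)
Definition tree_poly (t : nat) (h : {mpoly int[t]}) : Prop :=
  [/\ attention_poly h, has_degree h 2 & acyclic (graph_of h)].

Definition dotv (R : realType) (d : nat) (u v : 'rV[R]_d) : R :=
  \sum_(k < d) u 0 k * v 0 k.

(* Each edge is counted once, through its ordered pair i < j. *)
Definition eval_poly2 (R : realType) (t d : nat) (h : {mpoly int[t]})
    (Y : 'I_t -> 'rV[R]_d) : R :=
  \sum_(i < t) \sum_(j < t | (i < j)%N && graph_of h i j) dotv (Y i) (Y j).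

(* The variables are x_0, ..., x_t, so there are t.+1 of them, x_0 being the
   one whose index l1 is not summed over.  V j is attached to the variable of
   index j + 1.  The index vector l ranges over those with l_0 = l1. *)
Definition att_weight (R : realType) (t n d : nat) (h : {mpoly int[t.+1]})
    (Q : 'I_t.+1 -> 'M[R]_(n, d)) (l : {ffun 'I_t.+1 -> 'I_n}) : R :=
  expR (d%:R^-1 * eval_poly2 h (fun i => row (l i) (Q i))).

Definition Att (R : realType) (t n d : nat) (h : {mpoly int[t.+1]})
    (Q : 'I_t.+1 -> 'M[R]_(n, d)) (V : 'I_t -> 'M[R]_(n, d)) : 'M[R]_(n, d) :=
  \matrix_(l1 < n, k < d)
    ((\sum_(l : {ffun 'I_t.+1 -> 'I_n} | l ord0 == l1)
        att_weight h Q l * \prod_(j < t) V j (l (lift ord0 j)) k)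
     / (\sum_(l : {ffun 'I_t.+1 -> 'I_n} | l ord0 == l1) att_weight h Q l)).

(* A real RAM.  A program is a finite text using finitely many registers
   holding natural numbers and finitely many two-dimensional arrays of exact
   real numbers; an array entry is addressed by the name of the array and two
   registers.  Elementary instructions have unit cost, exp included.  To keep
   the unit cost of register operations realistic, registers can only be set,
   copied, added, subtracted (truncated at 0) and compared, and no instruction
   converts a real number into a natural number. *)

Inductive addr := Addr of nat & nat & nat. (* array, row register, column register *)

Inductive iexpr :=
  | IConst of nat
  | IReg of nat
  | IAdd of nat & nat
  | ISub of nat & nat.

Inductive rexpr :=
  | RConst of int
  | RCell of addr
  | RAdd of addr & addr
  | RSub of addr & addr
  | RMul of addr & addr
  | RDiv of addr & addr
  | RExp of addr.

Inductive test :=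
  | TIlt of nat & nat
  | TRlt of addr & addr.

Inductive prog :=
  | Skip
  | SetI of nat & iexpr
  | SetR of addr & rexpr
  | Seq of prog & prog
  | If of test & prog & prog
  | While of test & prog.

Record state (R : realType) := State {
  ireg : nat -> nat;
  mem : nat -> nat -> nat -> R }.

Section Semantics.
Variable R : realType.
Implicit Types s : state R.

Definition ieval s (e : iexpr) : nat :=
  match e with
  | IConst c => c
  | IReg x => ireg s x
  | IAdd x y => ireg s x + ireg s y
  | ISub x y => ireg s x - ireg s y
  end%N.

Definition cell s (a : addr) : R :=
  let: Addr m x y := a in mem s m (ireg s x) (ireg s y).

(* Division by zero has no value: a program attempting it has no execution. *)
Definition reval s (e : rexpr) : option R :=
  match e with
  | RConst c => Some c%:~R
  | RCell a => Some (cell s a)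
  | RAdd a b => Some (cell s a + cell s b)
  | RSub a b => Some (cell s a - cell s b)
  | RMul a b => Some (cell s a * cell s b)
  | RDiv a b => if cell s b == 0 then None else Some (cell s a / cell s b)
  | RExp a => Some (expR (cell s a))
  end.

Definition teval s (b : test) : bool :=
  match b with
  | TIlt x y => (ireg s x < ireg s y)%N
  | TRlt a b => cell s a < cell s b
  end.

Definition set_reg s (x v : nat) : state R :=
  State (fun y => if y == x then v else ireg s y) (mem s).

Definition set_cell s (a : addr) (v : R) : state R :=
  let: Addr m x y := a in
  State (ireg s)
    (fun m' i j => if [&& m' == m, i == ireg s x & j == ireg s y] then v
                   else mem s m' i j).

(* exec p s s' T: started in s, p halts in s' after T elementary steps. *)
Inductive exec : prog -> state R -> state R -> nat -> Prop :=
  | ExecSkip s : exec Skip s s 0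
  | ExecSetI s x e : exec (SetI x e) s (set_reg s x (ieval s e)) 1
  | ExecSetR s a e v : reval s e = Some v ->
      exec (SetR a e) s (set_cell s a v) 1
  | ExecSeq p q s s' s'' T T' : exec p s s' T -> exec q s' s'' T' ->
      exec (Seq p q) s s'' (T + T')
  | ExecIfTrue b p q s s' T : teval s b -> exec p s s' T ->
      exec (If b p q) s s' T.+1
  | ExecIfFalse b p q s s' T : ~~ teval s b -> exec q s s' T ->
      exec (If b p q) s s' T.+1
  | ExecWhileTrue b p s s' s'' T T' : teval s b ->
      exec p s s' T -> exec (While b p) s' s'' T' ->
      exec (While b p) s s'' (T + T').+1
  | ExecWhileFalse b p s : ~~ teval s b -> exec (While b p) s s 1.

(* Array m stores M.  Entries outside the range of M are unconstrained. *)
Definition stores s (m n d : nat) (M : 'M[R]_(n, d)) : Prop :=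
  forall (i : 'I_n) (k : 'I_d), mem s m i k = M i k.

(* Registers 0 and 1 hold n and d, arrays 0, ..., t hold the matrices Q, arrays
   t + 1, ..., 2 t the matrices V.  Nothing is assumed about the rest. *)
Definition att_input s (t n d : nat)
    (Q : 'I_t.+1 -> 'M[R]_(n, d)) (V : 'I_t -> 'M[R]_(n, d)) : Prop :=
  [/\ ireg s 0 = n, ireg s 1 = d,
      forall i : 'I_t.+1, stores s i (Q i)
    & forall j : 'I_t, stores s (t.+1 + j) (V j)].

(* On such inputs p halts within T steps with A in array 2 t + 1. *)
Definition att_computes (p : prog) (t n d : nat)
    (Q : 'I_t.+1 -> 'M[R]_(n, d)) (V : 'I_t -> 'M[R]_(n, d))
    (A : 'M[R]_(n, d)) (T : R) : Prop :=
  forall s, att_input s Q V ->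
    exists s' T', [/\ exec p s s' T', T'%:R <= T & stores s' (t + t).+1 A].

End Semantics.

(* Main.v *)
From mathcomp Require Import all_boot all_order all_algebra.
From mathcomp Require Import mpoly.
From mathcomp Require Import reals sequences exp.
From mathcomp Require Import zify ring.
Require Import Defs.

Import Order.TTheory GRing.Theory Num.Theory.
Local Open Scope ring_scope.

(** Message passing on a forest.  Every variable [i] carries weights
    [w_i : [n] -> R^(d+1)]; column [k < d] starts as column [k] of the matrix
    attached to [i] and column [d] starts as the all-ones vector.  A forest with
    at least two vertices has a vertex [v] other than the root [x_0] with at most
    one neighbour [p], and summing out [l_v] multiplies [w_p(x)] by
    [\sum_b exp(<Q_p x, Q_v b> / d) w_v(b)], at cost [O(n^2 d)].  If [v] has no
    neighbour, any [p] will do, with the inner product replaced by [0].  When only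
    the root is left, the quotient of columns [k] and [d] of its weights is
    column [k] of the attention matrix.  The total time [O(n^2 d)] is
    [O(n^2 log n)]. *)

(** * Graph elimination order *)

Section Forest.
Variables (T : finType) (e : rel T).
Hypotheses (e_sym : ssrbool.symmetric e) (e_irr : irreflexive e).
Hypothesis e_acyclic : acyclic e.
Implicit Type S : {set T}.

(** A path is extended at its head while the head has a neighbour in [S] off the path.
    Repetition-free paths have at most [#|T|] vertices, so [n] is enough fuel. *)
Lemma path_maximal S n y p : (#|T| <= size p + n)%N ->
  path e y p -> uniq (y :: p) -> {subset y :: p <= S} ->
  exists y' p', [/\ path e y' p', uniq (y' :: p'), {subset y' :: p' <= S},
    last y' p' = last y p /\ (size p <= size p')%N &
    forall z, z \in S -> e y' z -> z \in p'].
Proof.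
elim: n y p => [|n IH] y p hs hp hu hS.
  have := max_card (ssrbool.mem (y :: p)); rewrite (card_uniqP hu) /=.
  by move: hs; rewrite addn0; move: #|T| => N; lia.
have [/existsP[z /and3P[zS eyz zp]]|/existsPn H] :=
  boolP [exists z, [&& z \in S, e y z & z \notin y :: p]].
  have [||||y' [p' [h1 h2 h3 [h4 h5] h6]]] := IH z (y :: p).
  - by rewrite /= addSnnS.
  - by rewrite /= e_sym eyz.
  - by rewrite cons_uniq zp.
  - by move=> u; rewrite inE => /orP[/eqP ->|/hS].
  by exists y', p'; split=> //; split=> //; move: h5 => /=; lia.
exists y, p; split=> // z zS eyz.
have := H z; rewrite zS eyz /= negbK inE => /orP[/eqP zy|//].
by rewrite zy e_irr in eyz.
Qed.

(** The edge between [x] and [z] is grown into a maximal path ending at [x]. All neighbours in [S]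
    of its head [v] lie on it, and one other than the second vertex [p] would close a cycle. *)
Lemma leaf_from S x z : x \in S -> z \in S -> e x z ->
  exists v p, [/\ v \in S, v != x, p \in S, e v p &
    forall j, j \in S -> e v j -> j = p].
Proof.
move=> xS zS exz.
have [||||v [q [hp hu hS [hl hs] hmax]]] := @path_maximal S #|T| z [:: x].
- by lia.
- by rewrite /= e_sym exz.
- by rewrite /= inE andbT; apply: contraTneq exz => ->; rewrite e_irr.
- by move=> u; rewrite !inE => /orP[] /eqP ->.
case: q hp hu hS hl hs hmax => // p q hp hu hS hl _ hmax.
exists v, p; split.
- by apply: hS; rewrite inE eqxx.
- move: hu; rewrite cons_uniq => /andP[+ _]; apply: contraNneq => ->.
  by rewrite -[x]/(last z [:: x]) -hl /= mem_last.
- by apply: hS; rewrite !inE eqxx orbT.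
- by move: hp => /= /andP[].
move=> j jS evj; apply/eqP/negPn/negP => jp.
have := hmax j jS evj; rewrite inE (negbTE jp) /= => jq.
case/splitPr: jq hp hu {hS hl hmax} => q1 q2 hp hu.
(* The segment of the path from [v] to [j], closed by the edge between [j] and [v], is a simple
   cycle of length at least 3. *)
apply: (e_acyclic (v :: p :: rcons q1 j)); first by rewrite /= size_rcons.
rewrite /ucycle; apply/andP; split.
  move: hp; rewrite /= !rcons_path last_rcons cat_path /=.
  by move=> /andP[-> /andP[-> /andP[-> _]]]; rewrite e_sym evj.
by move: hu; rewrite -cat_rcons -!cat_cons cat_uniq => /andP[].
Qed.

(** A path grown from [r] reaches a leaf other than [r]. If [r] is isolated in [S], a path grown
    from another [v] serves, as its leaf has a neighbour and so is not [r]; if [v] is isolated too,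
    [v] itself serves. *)
Lemma leaf_avoiding S r : r \in S -> (1 < #|S|)%N ->
  exists v p, [/\ v \in S, v != r, p \in S, p != v &
    forall j, j \in S -> e v j -> j = p].
Proof.
move=> rS S2.
have neq v p : e v p -> p != v by apply: contraTneq => ->; rewrite e_irr.
have [/exists_inP[z zS erz]|/exists_inPn H] := boolP [exists z in S, e r z].
  have [v [p [h1 h2 h3 h4 h5]]] := leaf_from _ _ _ rS zS erz.
  by exists v, p; split=> //; exact: neq.
have [v] : exists v, v \in S :\ r.
  by apply/card_gt0P; move: (cardsD1 r S); rewrite rS; lia.
rewrite !inE => /andP[vr vS].
have [/exists_inP[z zS evz]|/exists_inPn H'] := boolP [exists z in S, e v z].
  have [u [p [h1 h2 h3 h4 h5]]] := leaf_from _ _ _ vS zS evz.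
  exists u, p; split=> //; last exact: neq.
  by apply: contraTneq h4 => ->; exact: H.
exists v, r; split=> //; first by rewrite eq_sym.
by move=> j jS; rewrite (negbTE (H' j jS)).
Qed.

(* [p] is arbitrary when [v] has no neighbour left. *)
Fixpoint elim_order (r : T) S (L : seq (T * T)) : Prop :=
  if L is (v, p) :: L' then
    [/\ v \in S, v != r, p \in S :\ v,
      forall j, j \in S :\ v -> e v j -> j = p & elim_order r (S :\ v) L']
  else S = [set r].

Lemma elim_order_exists r S : r \in S -> exists L, elim_order r S L.
Proof.
have [n] := ubnP #|S|; elim: n S => // n IH S Sn rS.
have [S2|S1] := ltnP 1 #|S|.
  have [v [p [vS vr pS pv hj]]] := leaf_avoiding _ _ rS S2.
  have [||L hL] := IH (S :\ v).
  - by move: Sn (cardsD1 v S); rewrite vS; lia.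
  - by rewrite !inE eq_sym vr.
  exists ((v, p) :: L); split=> //; first by rewrite !inE pv.
  by move=> j; rewrite !inE => /andP[_]; exact: hj.
exists [::]; apply/esym/eqP; rewrite eqEcard sub1set rS cards1 /=; lia.
Qed.

End Forest.

(** * Elimination of variables from sums *)

Section Elimination.
Variables (R : realType) (T X : finType) (r : T) (e : rel T).
Variable F : T -> T -> X -> X -> R.
Hypotheses (e_irr : irreflexive e)
  (F_sym : forall i j a b, F i j a b = F j i b a)
  (F0 : forall i j a b, ~~ e i j -> F i j a b = 0).
Implicit Types (S : {set T}) (l : {ffun T -> X}) (w : T -> X -> R).

(** The factor [2^-1] compensates for counting each edge in both orientations; diagonal terms vanish
    by [e_irr] and [F0]. *)
Definition energy S l : R :=
  2^-1 * \sum_(i in S) \sum_(j in S) F i j (l i) (l j).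

(* Sums over functions on [S] are encoded as sums over all of [{ffun T -> X}]
   with the coordinates outside [S] pinned to [a]. *)
Definition rooted S (a : X) l : bool :=
  [forall i, (i \in S) && (i != r) || (l i == a)].

(** Unnormalised marginal at the root of a pairwise graphical model with vertex weights [w] and
    interactions [F]. *)
Definition partition_fun S w (a : X) : R :=
  \sum_(l | rooted S a l) (\prod_(i in S) w i (l i)) * expR (energy S l).

Definition update l v b : {ffun T -> X} := [ffun i => if i == v then b else l i].

(** The factor multiplied into the weight of [vp.2] is the belief-propagation message from
    [vp.1]. *)
Definition absorb w (vp : T * T) : T -> X -> R := fun i x =>
  if i == vp.2
  then w i x * \sum_b expR (F i vp.1 x b) * w vp.1 b else w i x.

(** The sum is grouped by the fibres of the map resetting coordinate [v] to [a]; a fibre is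
    parametrised by the value at [v]. *)
Lemma sum_rooted S v a (f : {ffun T -> X} -> R) : v \in S -> v != r ->
  \sum_(l | rooted S a l) f l =
  \sum_(l | rooted (S :\ v) a l) \sum_b f (update l v b).
Proof.
move=> vS vr.
rewrite (partition_big (fun l => update l v a) (rooted (S :\ v) a)) /=; last first.
  move=> l /forallP hl; apply/forallP => i; rewrite ffunE !inE.
  by case: eqVneq => [_|_]; rewrite ?eqxx ?orbT //=; exact: hl.
apply: eq_bigr => l /forallP hl.
have lv : l v = a by have := hl v; rewrite !inE eqxx /= => /eqP.
rewrite (reindex_onto (update l v) (fun l' : {ffun T -> X} => l' v)) /=.
  apply: eq_bigl => b; rewrite ffunE eqxx eqxx andbT.
  apply/andP; split; last first.
    apply/eqP/ffunP => i; rewrite !ffunE; by case: eqVneq => [->|].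
  apply/forallP => i; rewrite ffunE.
  have [->|iv] := eqVneq i v; first by rewrite vS vr.
  by have := hl i; rewrite !inE iv.
move=> l' /andP[_ /eqP <-]; apply/ffunP => i; rewrite !ffunE.
by case: eqVneq => [->|].
Qed.

(** The pairs [(v, p)] and [(p, v)] contribute equally by [F_sym], so half of both is one [F p v];
    every other pair containing [v] vanishes. *)
Lemma energy_update S l v p b : v \in S -> p \in S :\ v ->
  (forall j, j \in S :\ v -> e v j -> j = p) ->
  energy S (update l v b) = energy (S :\ v) l + F p v (l p) b.
Proof.
move=> vS pS hj.
have lj j : j \in S :\ v -> update l v b j = l j.
  by rewrite !inE ffunE => /andP[/negbTE ->].
have lv : update l v b v = b by rewrite ffunE eqxx.
have inner x y : \sum_(j in S :\ v) F v j x (update l v y j) = F v p x (l p).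
  rewrite (bigD1 p) //= big1 ?addr0 => [|j /andP[jS jp]].
    by move: pS; rewrite !inE ffunE => /andP[/negbTE ->].
  by rewrite F0 //; apply: contraNN jp => /(hj j jS) ->.
have split i : \sum_(j in S) F i j (update l v b i) (update l v b j) =
    F i v (update l v b i) b +
    \sum_(j in S :\ v) F i j (update l v b i) (update l v b j).
  by rewrite (big_setD1 v vS) lv.
rewrite /energy (big_setD1 v vS) /= split inner lv F0 ?e_irr // add0r.
under eq_bigr => i iS do rewrite split F_sym.
rewrite big_split /= inner.
under [X in _ + (_ + X)]eq_bigr => i iS.
  rewrite lj //; under eq_bigr => j jS do rewrite lj //.
  over.
by rewrite F_sym; field.
Qed.

(** Distributivity: [b] occurs only in a factor that depends on [l] through [l p] alone, so the sum
    over [b] moves into the weight of [p]. *)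
Lemma partition_fun_absorb S w v p a : v \in S -> v != r -> p \in S :\ v ->
  (forall j, j \in S :\ v -> e v j -> j = p) ->
  partition_fun S w a = partition_fun (S :\ v) (absorb w (v, p)) a.
Proof.
move=> vS vr pS hj; rewrite /partition_fun (sum_rooted S v) //.
apply: eq_bigr => l _ /=.
under eq_bigr => b _.
  rewrite (energy_update _ _ _ _ _ vS pS hj) (big_setD1 v vS) /= ffunE eqxx.
  under eq_bigr => i do
    [rewrite !inE => /andP[/negbTE iv _]; rewrite ffunE iv].
  rewrite expRD; over.
rewrite (big_setD1 p pS) /= [in RHS](big_setD1 p pS) /=.
have -> : absorb w (v, p) p (l p) =
    w p (l p) * \sum_b expR (F p v (l p) b) * w v b by rewrite /absorb eqxx.
have -> : \prod_(i in S :\ v :\ p) absorb w (v, p) i (l i) =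
    \prod_(i in S :\ v :\ p) w i (l i).
  by apply: eq_bigr => i; rewrite !inE /absorb /= => /andP[/negbTE ->].
rewrite mulr_sumr !mulr_suml; apply: eq_bigr => b _; ring.
Qed.

Lemma partition_fun_elim L S w a : r \in S -> elim_order T e r S L ->
  partition_fun S w a = foldl absorb w L r a.
Proof.
elim: L S w => [|[v p] L IH] S w rS /=.
  move=> ->; rewrite /partition_fun.
  (* With only the root left every coordinate is pinned, so the sum has a single term. *)
  have rE l : rooted [set r] a l = (l == [ffun=> a]).
    apply/forallP/eqP => [h|-> i]; last by rewrite ffunE eqxx orbT.
    by apply/ffunP => i; rewrite ffunE; have := h i; rewrite inE andbN => /eqP.
  rewrite (big_pred1 [ffun=> a]) //.
  rewrite /energy !big_set1 ffunE F0 ?e_irr // mulr0 expR0 mulr1 //.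
move=> [vS vr pS hj hL]; rewrite (partition_fun_absorb _ _ _ _ _ vS vr pS hj) IH //.
by rewrite !inE eq_sym vr.
Qed.

Lemma partition_fun_setT w a :
  partition_fun [set: T] w a =
  \sum_(l : {ffun T -> X} | l r == a)
     (\prod_i w i (l i)) * expR (2^-1 * \sum_i \sum_j F i j (l i) (l j)).
Proof.
apply: eq_big => [l|l _].
  apply/forallP/idP => [/(_ r)|h i]; rewrite ?inE ?eqxx //=.
  by have [->|] := eqVneq i r; rewrite ?h ?orbT.
congr (_ * expR (_ * _)); first by apply: eq_bigl => i; rewrite inE.
apply: eq_big => [i|i _]; rewrite ?inE //.
by apply: eq_bigl => j; rewrite inE.
Qed.

End Elimination.

(** Bridges [eval_poly2], which sums over [i < j], and [energy], which sums over ordered pairs: the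
    sum equals its transpose and the diagonal is empty. *)
Lemma sum_ltn_half (R : realType) (t : nat) (e : rel 'I_t)
    (f : 'I_t -> 'I_t -> R) : ssrbool.symmetric e -> irreflexive e ->
  (forall i j, f i j = f j i) ->
  \sum_(i < t) \sum_(j < t | (i < j)%N && e i j) f i j =
  2^-1 * \sum_(i < t) \sum_(j < t) (if e i j then f i j else 0).
Proof.
move=> e_sym e_irr fC.
under eq_bigr => i _ do rewrite big_mkcond /=.
set S := LHS.
have S' : S = \sum_(i < t) \sum_(j < t) (if (j < i)%N && e i j then f i j else 0).
  rewrite /S exchange_big /=; apply: eq_bigr => i _; apply: eq_bigr => j _.
  by rewrite e_sym fC.
suff : \sum_(i < t) \sum_(j < t) (if e i j then f i j else 0) = S + S.
  by move=> ->; field.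
rewrite [X in _ = _ + X]S' /S -big_split; apply: eq_bigr => i _ /=.
rewrite -big_split; apply: eq_bigr => j _ /=.
case: (ltngtP i j) => [ij|ij|/val_inj ->]; rewrite ?e_irr /= ?addr0 ?add0r //.
Qed.

(** * Programs with syntactic frames and time bounds *)

(** An over-approximation read off the text, so that membership in a frame is decided by
    computation. *)
Fixpoint wreg (p : prog) : seq nat :=
  match p with
  | Skip | SetR _ _ => [::]
  | SetI x _ => [:: x]
  | Seq p q | If _ p q => wreg p ++ wreg q
  | While _ p => wreg p
  end.

Definition arr (a : addr) : nat := let: Addr m _ _ := a in m.

Fixpoint warr (p : prog) : seq nat :=
  match p with
  | Skip | SetI _ _ => [::]
  | SetR a _ => [:: arr a]
  | Seq p q | If _ p q => warr p ++ warr q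
  | While _ p => warr p
  end.

(* Register expressions have no immediate operands, so a register permanently
   holds the increment 1. *)
Definition rone : nat := 2.

Definition For (r b : nat) (p : prog) : prog :=
  Seq (SetI r (IConst 0))
      (While (TIlt r b) (Seq p (SetI r (IAdd r rone)))).

Section ProgramLogic.
Variable R : realType.
Implicit Types (s : state R) (p q : prog) (rs ms : seq nat).

Definition frame rs ms s s' : Prop :=
  (forall r, r \notin rs -> ireg s' r = ireg s r) /\
  (forall m, m \notin ms -> forall i j, mem s' m i j = mem s m i j).

Lemma frame_refl rs ms s : frame rs ms s s.
Proof. by split. Qed.

Lemma frame_trans rs ms s s' s'' :
  frame rs ms s s' -> frame rs ms s' s'' -> frame rs ms s s''.
Proof.
move=> [r1 m1] [r2 m2]; split=> [r hr|m hm i j]; first by rewrite r2 // r1.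
by rewrite m2 // m1.
Qed.

Lemma frame_sub rs ms rs' ms' s s' : {subset rs <= rs'} -> {subset ms <= ms'} ->
  frame rs ms s s' -> frame rs' ms' s s'.
Proof.
move=> hr hm [r1 m1]; split=> [r nr|m nm i j].
  by apply: r1; apply: contra nr => /hr.
by apply: m1; apply: contra nm => /hm.
Qed.

Lemma exec_frame {p s s' T} : exec p s s' T -> frame (wreg p) (warr p) s s'.
Proof.
elim=> {p s s' T} /=.
- by move=> s; exact: frame_refl.
- by move=> s x e; split=> //= r; rewrite inE => /negbTE ->.
- move=> s [m x y] e v _; split=> //= m'; rewrite inE => /negbTE /= h i j.
  by rewrite h.
- move=> p q s s' s'' T T' _ h1 _ h2; apply: (@frame_trans _ _ _ s').
    by apply: frame_sub h1 => z; rewrite mem_cat => ->.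
  by apply: frame_sub h2 => z; rewrite mem_cat orbC => ->.
- move=> b p q s s' T _ _; apply: frame_sub => z; rewrite mem_cat => -> //.
- by move=> b p q s s' T _ _; apply: frame_sub => z; rewrite mem_cat orbC => ->.
- by move=> b p s s' s'' T T' _ _ h1 _ h2; apply: frame_trans h1 h2.
- by move=> b p s _; exact: frame_refl.
Qed.

(** Total correctness with a time bound. Existence of a run also excludes divisions by zero. *)
Definition wp p s (B : nat) (P : state R -> Prop) : Prop :=
  exists s' T, [/\ exec p s s' T, (T <= B)%N & P s'].

(** The frame of [p] comes for free, so specifications need only state what [p] changes. *)
Lemma wp_mono p s B B' P P' : wp p s B P -> (B <= B')%N ->
  (forall s', frame (wreg p) (warr p) s s' -> P s' -> P' s') -> wp p s B' P'.
Proof.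
move=> [s' [T [ex hT hP]]] hB h; exists s', T; split=> //.
  exact: leq_trans hT hB.
by apply: h => //; exact: exec_frame ex.
Qed.

Lemma wp_skip s B P : P s -> wp Skip s B P.
Proof. by move=> h; exists s, 0%N; split=> //; constructor. Qed.

Lemma wp_seti s x e P : P (set_reg s x (ieval s e)) -> wp (SetI x e) s 1 P.
Proof.
by move=> h; exists (set_reg s x (ieval s e)), 1%N; split=> //; constructor.
Qed.

Lemma wp_setr s a e v P : reval s e = Some v -> P (set_cell s a v) ->
  wp (SetR a e) s 1 P.
Proof.
by move=> he h; exists (set_cell s a v), 1%N; split=> //; constructor.
Qed.

Lemma wp_seq p q s B1 B2 P1 P2 : wp p s B1 P1 ->
  (forall s', frame (wreg p) (warr p) s s' -> P1 s' -> wp q s' B2 P2) ->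
  wp (Seq p q) s (B1 + B2) P2.
Proof.
move=> [s' [T [ex hT hP]]] /(_ s' (exec_frame ex) hP) [s'' [T' [ex' hT' hP']]].
exists s'', (T + T')%N; split=> //; first exact: ExecSeq ex ex'.
exact: leq_add.
Qed.

(* The invariant ranges over memories only: registers other than the counter are
   controlled by the syntactic frame. *)
Lemma wp_for (I : nat -> (nat -> nat -> nat -> R) -> Prop) r b p N B s :
  ireg s b = N -> ireg s rone = 1%N -> r \notin [:: b; rone] ->
  r \notin wreg p -> b \notin wreg p -> rone \notin wreg p ->
  I 0%N (mem s) ->
  (forall k s', (k < N)%N -> frame (r :: wreg p) (warr p) s s' ->
     ireg s' r = k -> I k (mem s') -> wp p s' B (fun s'' => I k.+1 (mem s''))) ->
  wp (For r b p) s (N * (B + 2) + 2) (fun s' => I N (mem s')).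
Proof.
move=> hb h1; rewrite !inE negb_or => /andP[rb r1] hrp hbp h1p I0 step.
rewrite /For; set loop := While _ _.
(* With [m] rounds left: each round pays for a test and an increment beyond [B], and the final
   failing test costs 1. *)
suff main m k s' : (k + m = N)%N -> frame (r :: wreg p) (warr p) s s' ->
    ireg s' r = k -> I k (mem s') ->
    wp loop s' (m * (B + 2) + 1) (fun s' => I N (mem s')).
  set s1 := set_reg s r 0.
  have fs1 : frame (r :: wreg p) (warr p) s s1.
    by split=> //= x; rewrite inE negb_or => /andP[/negbTE ->].
  have /(main N 0%N s1 erefl fs1) : ireg s1 r = 0%N by rewrite /= eqxx.
  move=> /(_ I0) [s' [T [ex hT hI]]]; exists s', (1 + T)%N; split=> //.
    by apply: ExecSeq ex; exact: ExecSetI.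
  by move: hT; lia.
elim: m k s' => [|m IH] k s' km fs' hr hI.
  exists s', 1%N; rewrite addn0 in km; split=> //; last by rewrite -km.
  apply: ExecWhileFalse => /=; rewrite hr (fs'.1 b) ?hb ?km ?ltnn //.
  by rewrite inE negb_or eq_sym rb.
have kN : (k < N)%N by lia.
have [s'' [T [ex hT hI']]] := step k s' kN fs' hr hI.
have fr := exec_frame ex.
set s3 := set_reg s'' r k.+1.
have fs3 : frame (r :: wreg p) (warr p) s s3.
  apply: (frame_trans _ _ _ _ _ fs'); apply: (@frame_trans _ _ _ s'').
    by apply: frame_sub fr => // z; rewrite inE => ->; rewrite orbT.
  by split=> //= x; rewrite inE negb_or => /andP[/negbTE ->].
have [||s4 [T' [ex4 hT4 hI4]]] := IH k.+1 s3 _ fs3 _ hI'.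
- by lia.
- by rewrite /= eqxx.
exists s4, ((T + 1) + T').+1; split=> //; last by lia.
apply: ExecWhileTrue ex4 => /=.
  rewrite hr (fs'.1 b) ?hb //.
  by rewrite inE negb_or eq_sym rb.
apply: ExecSeq ex _.
have -> : s3 = set_reg s'' r (ieval s'' (IAdd r rone)).
  rewrite /s3 /= !fr.1 // hr (fs'.1 rone) ?h1 ?addn1 //.
  by rewrite inE negb_or eq_sym r1.
exact: ExecSetI.
Qed.

End ProgramLogic.

(** * The attention program *)

Section WpSeq.
Variable R : realType.
Implicit Types (s : state R).

Lemma wp_seq_setr s a e v q B (P : state R -> Prop) : reval s e = Some v ->
  wp R q (set_cell s a v) B P -> wp R (Seq (SetR a e) q) s B.+1 P.
Proof.
move=> he h; rewrite -add1n.
apply: (wp_seq _ _ _ _ _ _ (fun s' => s' = set_cell s a v)).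
  exact: wp_setr he _.
by move=> s' _ ->.
Qed.

Lemma wp_seq_seti s x e q B (P : state R -> Prop) :
  wp R q (set_reg s x (ieval s e)) B P -> wp R (Seq (SetI x e) q) s B.+1 P.
Proof.
move=> h; rewrite -add1n.
apply: (wp_seq _ _ _ _ _ _ (fun s' => s' = set_reg s x (ieval s e))).
  exact: wp_seti.
by move=> s' _ ->.
Qed.

End WpSeq.

(** Counters: [rx] for rows of the receiving vertex, [rb] for rows of the eliminated one, [rk] for
    columns. [rzero] stays 0 and addresses scalars. *)
Definition rx : nat := 4.
Definition rb : nat := 5.
Definition rk : nat := 6.
Definition rzero : nat := 7.
Definition rd1 : nat := 3.

Section Programs.
Variable t : nat.

(** Arrays up to [t + t] are the input and the next one is the output, so scratch space starts
    here. *)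
Definition adim : nat := (t + t).+2.
Definition adot : nat := adim + 1.
Definition atmp : nat := adim + 2.
Definition aacc : nat := adim + 3.
Definition awt (i : nat) : nat := adim + 4 + i.

Ltac array_neq := rewrite /= ?inE /arr /= ?/awt ?/aacc ?/adot ?/atmp ?/adim; lia.

Definition dim_cell := Addr adim rzero rzero.
Definition dot_cell := Addr adot rzero rzero.
Definition tmp_cell := Addr atmp rzero rzero.

(* No instruction converts a register into a real, so [d] is obtained by adding
   1 to 0, [d] times. *)
Definition prologue_prog : prog :=
  Seq (SetI rone (IConst 1)) (Seq (SetI rzero (IConst 0))
  (Seq (SetI rd1 (IAdd 1 rone)) (Seq (SetR dim_cell (RConst 0))
  (Seq (SetR tmp_cell (RConst 1))
    (For rk 1 (SetR dim_cell (RAdd dim_cell tmp_cell))))))).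

(* [rd1] holds [d + 1], the number of columns of the weight arrays [awt i];
   column [d] is the denominator column. *)
Definition ones_prog (i : nat) : prog :=
  For rx 0 (For rk rd1 (SetR (Addr (awt i) rx rk) (RConst 1))).

(** Run after [ones_prog] on the first [d] columns only, so column [d] keeps its ones. *)
Definition copy_prog (j : nat) : prog :=
  For rx 0 (For rk 1
    (SetR (Addr (awt j.+1) rx rk) (RCell (Addr (t.+1 + j) rx rk)))).

(** The recursion is unrolled in the program text, since [t] is constant. Variable 0 has no value
    matrix and keeps weight 1. *)
Fixpoint init_prog (m : nat) : prog :=
  if m is j.+1 then Seq (init_prog j) (Seq (ones_prog j.+1) (copy_prog j))
  else ones_prog 0.

(** The flag [f] tells whether [v] and [p] are adjacent and is fixed in the text; without an edge
    the loop adds zeros at the same cost. *)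
Definition dot_prog (f : bool) (v p : nat) : prog :=
  For rk 1 (Seq (SetR tmp_cell
      (if f then RMul (Addr p rx rk) (Addr v rb rk) else RConst 0))
                (SetR dot_cell (RAdd dot_cell tmp_cell))).

Definition kernel_prog (f : bool) (v p : nat) : prog :=
  Seq (SetR dot_cell (RConst 0)) (Seq (dot_prog f v p)
  (Seq (SetR dot_cell (RDiv dot_cell dim_cell)) (SetR dot_cell (RExp dot_cell)))).

Definition addrow_prog (v : nat) : prog :=
  For rk rd1 (Seq (SetR tmp_cell (RMul dot_cell (Addr (awt v) rb rk)))
    (SetR (Addr aacc rzero rk) (RAdd (Addr aacc rzero rk) tmp_cell))).

Definition clear_prog : prog :=
  For rk rd1 (SetR (Addr aacc rzero rk) (RConst 0)).

Definition scale_prog (p : nat) : prog :=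
  For rk rd1 (SetR (Addr (awt p) rx rk)
    (RMul (Addr (awt p) rx rk) (Addr aacc rzero rk))).

Definition absorb_prog (f : bool) (v p : nat) : prog :=
  For rx 0 (Seq clear_prog
    (Seq (For rb 0 (Seq (kernel_prog f v p) (addrow_prog v)))
         (scale_prog p))).

(** In [Addr (awt 0) rx 1] the last [1] is a register, which holds [d]: the divisor is the
    denominator column. *)
Definition output_prog : prog :=
  For rx 0 (For rk 1 (SetR (Addr (t + t).+1 rx rk)
    (RDiv (Addr (awt 0) rx rk) (Addr (awt 0) rx 1)))).

(** * Correctness and cost of the program pieces *)

Variables (R : realType) (n d : nat) (m0 : nat -> nat -> nat -> R).
Implicit Types s : state R.

(** What holds from the prologue on; [m0] is the initial memory, whose input arrays are never
    overwritten. *)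
Definition env s : Prop :=
  [/\ [/\ ireg s 0 = n, ireg s 1 = d, ireg s rone = 1%N, ireg s rd1 = d.+1
        & ireg s rzero = 0%N],
      mem s adim 0 0 = d%:R &
      forall m, (m <= t + t)%N -> forall i j, mem s m i j = m0 m i j].

Lemma env_frame rs ms s s' : frame R rs ms s s' ->
  all (fun r => r \in [:: rx; rb; rk]) rs ->
  all (fun m => (adim < m)%N || (m == (t + t).+1)) ms -> env s -> env s'.
Proof.
move=> [fr fm] /allP hr /allP hm [[r0 r1 r2 r3 r7] hd h0].
have nr r : r \notin [:: rx; rb; rk] -> ireg s' r = ireg s r.
  by move=> h; apply: fr; apply: contra h => /hr.
have nm m : (m <= adim)%N -> m != (t + t).+1 ->
    forall i j, mem s' m i j = mem s m i j.
  move=> h h'; apply: fm; apply/negP => /hm; rewrite (negbTE h') orbF.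
  by rewrite ltnNge h.
split; first by rewrite !nr.
  by rewrite nm //; rewrite /adim; lia.
move=> m hmt i j; rewrite nm ?h0 //; rewrite /adim; lia.
Qed.

Lemma prologue_spec s : ireg s 0 = n -> ireg s 1 = d ->
  (forall m, (m <= t + t)%N -> forall i j, mem s m i j = m0 m i j) ->
  wp R prologue_prog s (d * 3 + 7) env.
Proof.
move=> h0 h1 hm.
(* Five assignments, then a loop of [d] rounds with a body of one step. *)
rewrite (_ : d * 3 + 7 = (d * (1 + 2) + 2).+4.+1)%N; last by lia.
do 3 apply: wp_seq_seti; do 2 (apply: wp_seq_setr; first by []).
set s1 := set_cell _ _ _.
pose I k (mu : nat -> nat -> nat -> R) :=
  mu adim 0%N 0%N = k%:R /\ mu atmp 0%N 0%N = 1.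
have at_ad : (atmp == adim) = false by rewrite /atmp; lia.
have ad_at : (adim == atmp) = false by rewrite eq_sym.
apply: wp_mono (wp_for _ I rk 1 _ d 1 _ _ _ _ _ _ _ _ _) _ _ => //=.
- by rewrite /I ad_at !eqxx.
- move=> k s' kd [fr fm] hk [i0 i1]; apply: wp_setr => //=.
  have z : ireg s' rzero = 0%N by rewrite fr.
  by split=> /=; rewrite z !eqxx /= ?at_ad // i0 i1 -natr1.
move=> s' [fr fm] [id _]; split=> //.
  by split; rewrite fr //= ?h1 ?addn1.
move=> m hmt i j; rewrite fm /=; last by rewrite inE /adim; lia.
have -> : (m == adim) = false by rewrite /adim; lia.
have -> : (m == atmp) = false by rewrite /atmp /adim; lia.
exact: hm.
Qed.

Definition logit (f : bool) (p v x b : nat) : R :=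
  (\sum_(k < d) if f then m0 p x k * m0 v b k else 0) / d%:R.

Lemma dot_spec s f v p : env s -> (v <= t)%N -> (p <= t)%N ->
  mem s adot 0%N 0%N = 0 ->
  wp R (dot_prog f v p) s (d * 4 + 2) (fun s' => mem s' adot 0%N 0%N =
    \sum_(k < d) if f then m0 p (ireg s rx) k * m0 v (ireg s rb) k else 0).
Proof.
move=> [[r0 r1 r2 r3 r7] hd h0] vt pt hz.
have dt : (adot == atmp) = false by rewrite /atmp /adot; lia.
apply: (wp_for _ (fun N mu => mu adot 0%N 0%N =
  \sum_(k < N) if f then m0 p (ireg s rx) k * m0 v (ireg s rb) k else 0)
  rk 1 _ d 2) => //.
  by rewrite big_ord0.
move=> k s' kd [fr fm] hk hI.
apply: (wp_seq_setr _ _ _ _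
  (if f then m0 p (ireg s rx) k * m0 v (ireg s rb) k else 0)).
  case: (f); rewrite //= hk !fr // !fm ?h0 //;
    by array_neq.
apply: wp_setr => //=.
by rewrite !fr // r7 !eqxx dt /= hI big_ord_recr.
Qed.

Lemma kernel_spec s f v p : (0 < d)%N -> env s -> (v <= t)%N -> (p <= t)%N ->
  wp R (kernel_prog f v p) s (d * 4 + 5)
    (fun s' => mem s' adot 0%N 0%N = expR (logit f p v (ireg s rx) (ireg s rb))).
Proof.
move=> d_gt0 es vt pt; have [[r0 r1 r2 r3 r7] hd h0] := es.
rewrite (_ : d * 4 + 5 = (d * 4 + 2 + 2).+1)%N; last by lia.
apply: wp_seq_setr => //; set s1 := set_cell _ _ _.
have fs1 : frame R [::] [:: adot] s s1.
  by have := exec_frame R (ExecSetR dot_cell (erefl : reval s (RConst 0) = Some _)).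
have es1 : env s1 by apply: env_frame fs1 _ _ es => //=; rewrite /adot /adim; lia.
have z1 : mem s1 adot 0%N 0%N = 0 by rewrite /= r7 !eqxx.
apply: wp_seq (dot_spec s1 f v p es1 vt pt z1) _ => s' fs' hs'.
have [[_ _ _ _ q7] qd _] : env s'.
  by apply: env_frame fs' _ _ es1 => //=; rewrite /adot /atmp /adim; lia.
apply: (wp_seq_setr _ _ _ _ (mem s' adot 0%N 0%N / d%:R)).
  by rewrite /= q7 qd pnatr_eq0 (gtn_eqF d_gt0).
apply: wp_setr => //=.
by rewrite q7 !eqxx /= hs'.
Qed.

Lemma addrow_spec s v : env s ->
  wp R (addrow_prog v) s (d.+1 * 4 + 2)
    (fun s' => forall k, (k < d.+1)%N -> mem s' aacc 0%N k =
       mem s aacc 0%N k + mem s adot 0%N 0%N * mem s (awt v) (ireg s rb) k).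
Proof.
move=> [[r0 r1 r2 r3 r7] hd h0].
pose I N (mu : nat -> nat -> nat -> R) := forall k, mu aacc 0%N k =
       mem s aacc 0%N k + (if (k < N)%N then
         mem s adot 0%N 0%N * mem s (awt v) (ireg s rb) k else 0).
apply: wp_mono (wp_for _ I _ _ _ d.+1 2 _ _ _ _ _ _ _ _ _) _ _ => //.
- by move=> k; rewrite addr0.
- move=> k s' kd [fr fm] hk hI.
  apply: wp_seq_setr => //; apply: wp_setr => //= j.
  have at1 : (aacc == atmp) = false by rewrite /atmp /aacc; lia.
  rewrite hk !fr // r7 !eqxx /= at1 /= !hI ltnS.
  rewrite (fm adot); last by array_neq.
  rewrite (fm (awt v)); last by array_neq.
  have [->|jk] := eqVneq j k; first by rewrite ltnn addr0 leqnn.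
  by rewrite [in RHS]leq_eqVlt (negbTE jk).
by move=> s' _ hI k kd; rewrite hI kd.
Qed.

Lemma clear_spec s : env s ->
  wp R clear_prog s (d.+1 * 3 + 2)
    (fun s' => forall k, (k < d.+1)%N -> mem s' aacc 0%N k = 0).
Proof.
move=> [[r0 r1 r2 r3 r7] hd h0].
apply: (wp_for _ (fun N mu => forall k, (k < N)%N -> mu aacc 0%N k = 0)
  rk rd1 _ d.+1 1) => //.
move=> k s' kd [fr fm] hk hI; apply: wp_setr => //= j.
rewrite hk fr // r7 !eqxx /= ltnS leq_eqVlt.
by case: eqVneq => //= _; exact: hI.
Qed.

Lemma scale_spec s p : env s ->
  wp R (scale_prog p) s (d.+1 * 3 + 2)
    (fun s' => forall y k, (k < d.+1)%N -> mem s' (awt p) y k =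
      mem s (awt p) y k * (if y == ireg s rx then mem s aacc 0%N k else 1)).
Proof.
move=> [[r0 r1 r2 r3 r7] hd h0].
pose I N (mu : nat -> nat -> nat -> R) := forall y k, mu (awt p) y k =
      mem s (awt p) y k *
      (if (y == ireg s rx) && (k < N)%N then mem s aacc 0%N k else 1).
apply: wp_mono (wp_for _ I _ _ _ d.+1 1 _ _ _ _ _ _ _ _ _) _ _ => //.
- by move=> y k; rewrite andbF mulr1.
- move=> k s' kd [fr fm] hk hI; apply: wp_setr => //= y j.
  rewrite hk !fr // r7 !eqxx /= !hI ltnS eqxx ltnn /= mulr1.
  rewrite fm; last by array_neq.
  have [->|yx] /= := eqVneq y (ireg s rx); last by [].
  have [->|jk] := eqVneq j k; first by rewrite leqnn.
  by rewrite [in RHS]leq_eqVlt (negbTE jk).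
by move=> s' _ hI y k kd; rewrite hI kd andbT.
Qed.

Definition absorb_cost : nat :=
  n * ((d.+1 * 3 + 2) +
       ((n * ((d * 4 + 5) + (d.+1 * 4 + 2) + 2) + 2) + (d.+1 * 3 + 2)) + 2) + 2.

(** The rows of [awt p] are overwritten in place; [v != p] keeps the weights of [v] intact
    meanwhile. *)
Lemma absorb_spec s f v p :
  (0 < d)%N -> env s -> (v <= t)%N -> (p <= t)%N -> v != p ->
  wp R (absorb_prog f v p) s absorb_cost
    (fun s' => forall i x k, (i <= t)%N -> (x < n)%N -> (k < d.+1)%N ->
      mem s' (awt i) x k = if i == p
        then mem s (awt p) x k *
          \sum_(b < n) expR (logit f p v x b) * mem s (awt v) b k
        else mem s (awt i) x k).
Proof.
move=> d_gt0 es vt pt vp; have [[r0 r1 r2 r3 r7] hd h0] := es.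
set g := fun x k => \sum_(b < n) expR (logit f p v x b) * mem s (awt v) b k.
pose I N (mu : nat -> nat -> nat -> R) := forall y k, (k < d.+1)%N ->
  mu (awt p) y k = if (y < N)%N then mem s (awt p) y k * g y k
                   else mem s (awt p) y k.
apply: wp_mono (wp_for _ I _ _ _ n
  ((d.+1 * 3 + 2) + ((n * ((d * 4 + 5) + (d.+1 * 4 + 2) + 2) + 2) +
    (d.+1 * 3 + 2))) _ _ _ _ _ _ _ _ _) _ _ => //.
- move=> x s1 xn fs1 hx hI.
  have es1 : env s1.
    by apply: env_frame fs1 _ _ es => //=; rewrite /awt /aacc /adot /atmp; lia.
  apply: wp_seq (clear_spec s1 es1) _ => s2 fs2 hs2.
  have es2 : env s2.
    by apply: env_frame fs2 _ _ es1 => //=; rewrite /awt /aacc /adot /atmp; lia.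
  have [[q0 _ q2 _ _] _ _] := es2.
  pose J N (mu : nat -> nat -> nat -> R) := forall k, (k < d.+1)%N ->
    mu aacc 0%N k = \sum_(b < N) expR (logit f p v x b) * mem s (awt v) b k.
  have x2 : ireg s2 rx = x by rewrite (fs2.1 rx).
  have v2 b k : mem s2 (awt v) b k = mem s (awt v) b k.
    by rewrite (fs2.2 (awt v)) ?(fs1.2 (awt v)) //; array_neq.
  apply: (wp_seq _ _ _ _ _ _ (fun s' => J n (mem s'))).
    apply: (wp_for _ J rb _ _ n ((d * 4 + 5) + (d.+1 * 4 + 2))) => //.
      by move=> k kd; rewrite hs2 // big_ord0.
    move=> b s3 bn fs3 hb hJ.
    have es3 : env s3.
      by apply: env_frame fs3 _ _ es2 => //=; array_neq.
    apply: wp_seq (kernel_spec s3 f v p d_gt0 es3 vt pt) _ => s4 fs4 hs4.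
    have es4 : env s4.
      by apply: env_frame fs4 _ _ es3 => //=; array_neq.
    apply: wp_mono (addrow_spec s4 v es4) (leqnn _) _ => s5 _ hs5 k kd.
    rewrite hs5 // big_ord_recr /= hs4 (fs4.1 rb) // hb (fs3.1 rx) // x2.
    rewrite (fs4.2 aacc); last by array_neq.
    rewrite (fs4.2 (awt v)); last by array_neq.
    rewrite (fs3.2 (awt v)); last by array_neq.
    by rewrite hJ // v2.
  move=> s3 fs3 hs3.
  have es3 : env s3.
    by apply: env_frame fs3 _ _ es2 => //=; array_neq.
  apply: wp_mono (scale_spec s3 p es3) (leqnn _) _ => s4 _ hs4 y k kd.
  rewrite hs4 // (fs3.1 rx) // x2.
  rewrite (fs3.2 (awt p)); last by array_neq.
  rewrite (fs2.2 (awt p)); last by array_neq.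
  rewrite hI // hs3 // ltnS [in RHS]leq_eqVlt.
  by have [->|] := eqVneq y x; rewrite ?ltnn ?mulr1.
move=> s' fs' hI i x k it xn kd; case: eqVneq => [->|ip].
  by rewrite hI // xn.
by rewrite fs'.2 //; array_neq.
Qed.

Lemma ones_spec s i : env s ->
  wp R (ones_prog i) s (n * ((d.+1 * 3 + 2) + 2) + 2)
    (fun s' => forall x k, (x < n)%N -> (k < d.+1)%N -> mem s' (awt i) x k = 1).
Proof.
move=> es; have [[r0 r1 r2 r3 r7] hd h0] := es.
apply: (wp_for _ (fun N mu => forall x k, (x < N)%N -> (k < d.+1)%N ->
  mu (awt i) x k = 1) rx 0 _ n (d.+1 * 3 + 2)) => //.
move=> x s1 xn fs1 hx hI.
have [[_ _ q2 q3 _] _ _] : env s1.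
  by apply: env_frame fs1 _ _ es => //=; array_neq.
(* Invariants see only the memory, so the inner one also records the rows finished by the outer
   loop. *)
pose J N (mu : nat -> nat -> nat -> R) := forall y k, (y <= x)%N -> (k < d.+1)%N ->
  (y < x)%N || (k < N)%N -> mu (awt i) y k = 1.
apply: wp_mono (wp_for _ J rk rd1 _ d.+1 1 s1 q3 q2 _ _ _ _ _ _) (leqnn _) _ => //.
- by move=> y k yx kd; rewrite orbF => yx'; exact: hI.
- move=> k s2 kd [fr fm] hk hJ; apply: wp_setr => //= y j yx jd H.
  rewrite fr // hx hk eqxx /=; case: ifP => // /negbT h; apply: hJ => //; lia.
by move=> s2 _ hJ y k yx kd; apply: hJ => //; rewrite kd orbT.
Qed.

Lemma copy_spec s j : env s -> (j < t)%N ->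
  wp R (copy_prog j) s (n * ((d * 3 + 2) + 2) + 2)
    (fun s' => forall x k, (x < n)%N -> mem s' (awt j.+1) x k =
       if (k < d)%N then mem s (t.+1 + j) x k else mem s (awt j.+1) x k).
Proof.
move=> es jt; have [[r0 r1 r2 r3 r7] hd h0] := es.
pose I N (mu : nat -> nat -> nat -> R) := forall x k, mu (awt j.+1) x k =
  if (x < N)%N && (k < d)%N then mem s (t.+1 + j) x k else mem s (awt j.+1) x k.
apply: wp_mono (wp_for _ I rx 0 _ n (d * 3 + 2) s r0 r2 _ _ _ _ _ _) (leqnn _) _
  => //.
move=> x s1 xn fs1 hx hI.
have [[_ q1 q2 _ _] _ _] : env s1.
  by apply: env_frame fs1 _ _ es => //=; array_neq.
pose J N (mu : nat -> nat -> nat -> R) := forall y k, mu (awt j.+1) y k =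
  if ((y < x)%N || (y == x) && (k < N)%N) && (k < d)%N
  then mem s (t.+1 + j) y k else mem s (awt j.+1) y k.
apply: wp_mono (wp_for _ J rk 1 _ d 1 s1 q1 q2 _ _ _ _ _ _) (leqnn _) _ => //.
- by move=> y k; rewrite hI andbF orbF.
- move=> k s2 kd [fr fm] hk hJ; apply: wp_setr => //= y i.
  rewrite fr // hx hk eqxx /= hJ fm; last by array_neq.
  rewrite (fs1.2 (t.+1 + j)%N); last by array_neq.
  case: eqVneq => [->|yx] /=; last by case: ltngtP yx.
  rewrite ltnn /=; case: eqVneq => [->|ik] /=; first by rewrite ltnSn kd.
  by rewrite ltnS [in RHS]leq_eqVlt (negbTE ik).
- move=> s2 _ hJ y k; rewrite hJ ltnS [(y <= x)%N in RHS]leq_eqVlt.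
  by case: (y == x); case: (y < x)%N; case: (k < d)%N.
by move=> s' _ hI x k xn; rewrite hI xn.
Qed.

(** The matrix of variable [i = j + 1] is [V j], stored in array [t + 1 + j = t + i]. *)
Definition init_weight (i x k : nat) : R :=
  if (0 < i)%N && (k < d)%N then m0 (t + i) x k else 1.

Lemma init_spec m s : env s -> (m <= t)%N ->
  wp R (init_prog m) s (m.+1 * ((n * ((d.+1 * 3 + 2) + 2) + 2) +
                         (n * ((d * 3 + 2) + 2) + 2)))
    (fun s' => env s' /\ forall i x k, (i <= m)%N -> (x < n)%N -> (k < d.+1)%N ->
       mem s' (awt i) x k = init_weight i x k).
Proof.
elim: m s => [|m IH] s es mt.
  apply: wp_mono (ones_spec s 0 es) _ _.
    by rewrite mul1n leq_addr.
  move=> s' fs' hs'; split.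
    by apply: env_frame fs' _ _ es => //=; array_neq.
  by move=> i x k; rewrite leqn0 => /eqP ->; exact: hs'.
rewrite mulSnr; apply: wp_seq (IH s es (ltnW mt)) _ => s1 fs1 [es1 hs1].
apply: wp_seq (ones_spec s1 m.+1 es1) _ => s2 fs2 hs2.
have es2 : env s2 by apply: env_frame fs2 _ _ es1 => //=; array_neq.
apply: wp_mono (copy_spec s2 m es2 mt) (leqnn _) _ => s3 fs3 hs3.
have es3 : env s3 by apply: env_frame fs3 _ _ es2 => //=; array_neq.
split=> // i x k im xn kd; have [->|im'] := eqVneq i m.+1.
  rewrite hs3 // /init_weight /=; case: ifP => // kd'; last by rewrite hs2.
  have [_ _ h] := es2; rewrite h; last by lia.
  by rewrite addSnnS.
rewrite (fs3.2 (awt i)); last by array_neq.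
rewrite (fs2.2 (awt i)); last by array_neq.
by rewrite hs1 //; lia.
Qed.

Lemma output_spec s : env s ->
  (forall x, (x < n)%N -> mem s (awt 0) x d != 0) ->
  wp R output_prog s (n * ((d * 3 + 2) + 2) + 2)
    (fun s' => forall x k, (x < n)%N -> (k < d)%N ->
       mem s' (t + t).+1 x k = mem s (awt 0) x k / mem s (awt 0) x d).
Proof.
move=> es hz; have [[r0 r1 r2 r3 r7] hd h0] := es.
apply: (wp_for _ (fun N mu => forall x k, (x < N)%N -> (k < d)%N ->
  mu (t + t).+1 x k = mem s (awt 0) x k / mem s (awt 0) x d)
  rx 0 _ n (d * 3 + 2)) => //.
move=> x s1 xn fs1 hx hI.
have [[_ q1 q2 _ _] _ _] : env s1.
  apply: env_frame fs1 _ _ es => //=; rewrite eqxx; array_neq.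
pose J N (mu : nat -> nat -> nat -> R) := forall y k, (y <= x)%N -> (k < d)%N ->
  (y < x)%N || (k < N)%N ->
  mu (t + t).+1 y k = mem s (awt 0) y k / mem s (awt 0) y d.
apply: wp_mono (wp_for _ J rk 1 _ d 1 s1 q1 q2 _ _ _ _ _ _) (leqnn _) _ => //.
- by move=> y k yx kd; rewrite orbF => yx'; exact: hI.
- move=> k s2 kd fs2 hk hJ.
  have w2 y j : mem s2 (awt 0) y j = mem s (awt 0) y j.
    by rewrite (fs2.2 (awt 0)) ?(fs1.2 (awt 0)) //; array_neq.
  apply: (wp_setr _ _ _ _ (mem s (awt 0) x k / mem s (awt 0) x d)).
    by rewrite /= !(fs2.1 rx) // (fs2.1 1%N) // hx hk q1 !w2 (negbTE (hz x xn)).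
  move=> /= y j yx jd H.
  rewrite !(fs2.1 rx) // hx hk eqxx /=; case: ifP => [/andP[/eqP -> /eqP ->]//|].
  move=> /negbT h; apply: hJ => //; lia.
by move=> s2 _ hJ y k yx kd; apply: hJ => //; rewrite kd orbT.
Qed.

End Programs.

(** * Correctness and running time *)

Lemma graph_of_sym t (h : {mpoly int[t]}) : ssrbool.symmetric (graph_of h).
Proof. by move=> i j; rewrite /graph_of eq_sym addmC. Qed.

Lemma graph_of_irr t (h : {mpoly int[t]}) : irreflexive (graph_of h).
Proof. by move=> i; rewrite /graph_of eqxx. Qed.

Section Tree.
Variables (t : nat) (h : {mpoly int[t.+1]}).
Local Notation e := (graph_of h).
Implicit Type L : seq ('I_t.+1 * 'I_t.+1).

(** The graph is compiled into the text: adjacency is evaluated when the program is built, not when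
    it runs. *)
Definition elim_prog L : prog :=
  foldr (fun vp => Seq (absorb_prog t (e vp.2 vp.1) vp.1 vp.2)) Skip L.

Definition att_prog L : prog :=
  Seq (prologue_prog t) (Seq (init_prog t t) (Seq (elim_prog L) (output_prog t))).

Lemma elim_order_neq r S L : elim_order _ e r S L ->
  all (fun vp => vp.1 != vp.2) L.
Proof.
elim: L S => // [[v p] L] IH S [_ _ pS _ hL] /=; apply/andP; split.
  by move: pS; rewrite !inE eq_sym => /andP[].
exact: IH hL.
Qed.

Section Run.
Variables (R : realType) (n d : nat) (m0 : nat -> nat -> nat -> R).
Hypothesis d_gt0 : (0 < d)%N.

Definition edge_logit (i j : 'I_t.+1) (a b : 'I_n) : R :=
  logit R d m0 (e i j) i j a b.

Lemma edge_logit_sym i j a b : edge_logit i j a b = edge_logit j i b a.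
Proof.
rewrite /edge_logit /logit graph_of_sym; congr (_ / _).
by apply: eq_bigr => k _; rewrite mulrC.
Qed.

Lemma edge_logit0 i j a b : ~~ e i j -> edge_logit i j a b = 0.
Proof.
by rewrite /edge_logit /logit => /negbTE ->; rewrite sumr_const mul0rn mul0r.
Qed.

Definition weights_are (s : state R) (w : nat -> 'I_t.+1 -> 'I_n -> R) : Prop :=
  forall k, (k < d.+1)%N ->
    forall (i : 'I_t.+1) (x : 'I_n), mem s (awt t i) x k = w k i x.

(** The kernel does not depend on the column, so all [d + 1] columns undergo the same elimination
    independently. *)
Lemma elim_spec L s w : all (fun vp => vp.1 != vp.2) L ->
  env t R n d m0 s -> weights_are s w ->
  wp R (elim_prog L) s (size L * absorb_cost n d)
    (fun s' => env t R n d m0 s' /\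
      weights_are s' (fun k => foldl (absorb R _ _ edge_logit) (w k) L)).
Proof.
elim: L s w => [|[v p] L IH] s w /=; first by move=> *; exact: wp_skip.
move=> /andP[vp hL] es hw; rewrite mulSn.
have vt : (v <= t)%N by rewrite -ltnS.
have pt : (p <= t)%N by rewrite -ltnS.
apply: wp_seq (absorb_spec t R n d m0 s (e p v) v p d_gt0 es vt pt vp) _.
move=> s1 fs1 hs1; apply: IH => //.
  by apply: env_frame fs1 _ _ es => //=; rewrite /awt /aacc /adot /atmp; lia.
move=> k kd i x; rewrite hs1 //; last by rewrite -ltnS.
rewrite /absorb /= -val_eqE /=; case: eqVneq => [/val_inj ->|_]; rewrite !hw //.
by congr (_ * _); apply: eq_bigr => b _; rewrite hw.
Qed.

Lemma att_spec L s : elim_order _ e ord0 [set: 'I_t.+1] L ->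
  ireg s 0 = n -> ireg s 1 = d -> 
  (forall m, (m <= t + t)%N -> forall i j, mem s m i j = m0 m i j) ->
  let Z k := partition_fun R _ _ ord0 edge_logit [set: 'I_t.+1]
    (fun i x => init_weight t R d m0 i x k) in
  (forall a, Z d a != 0) ->
  wp R (att_prog L) s
    ((d * 3 + 7) + (t.+1 * ((n * ((d.+1 * 3 + 2) + 2) + 2) +
       (n * ((d * 3 + 2) + 2) + 2)) +
     (size L * absorb_cost n d + (n * ((d * 3 + 2) + 2) + 2))))
    (fun s' => forall (a : 'I_n) (k : 'I_d),
       mem s' (t + t).+1 a k = Z k a / Z d a).
Proof.
move=> hL h0 h1 hm Z hZ.
apply: wp_seq (prologue_spec t R n d m0 s h0 h1 hm) _ => s1 _ es1.
apply: wp_seq (init_spec t R n d m0 t s1 es1 (leqnn t)) _ => s2 _ [es2 hs2].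
apply: wp_seq (elim_spec L s2
  (fun k i x => init_weight t R d m0 i x k) (elim_order_neq _ _ _ hL) es2 _) _.
  by move=> k kd i x; rewrite hs2 // -ltnS.
move=> s3 _ [es3 hs3].
have hs k (a : 'I_n) : (k < d.+1)%N -> mem s3 (awt t 0) a k = Z k a.
  move=> kd; have /= -> := hs3 k kd ord0 a.
  rewrite /Z (partition_fun_elim _ _ _ _ e _ _ _ _ L) ?inE //.
  - exact: graph_of_irr.
  - exact: edge_logit_sym.
  - exact: edge_logit0.
apply: wp_mono (output_spec t R n d m0 s3 es3 _) (leqnn _) _.
  by move=> x xn; rewrite (hs d (Ordinal xn)).
by move=> s4 _ hs4 a k; rewrite hs4 // !hs // ltnS ltnW.
Qed.

End Run.
End Tree.

(** * Attention entries as quotients of partition functions *)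

Section AttentionValue.
Variables (R : realType) (t n d : nat) (h : {mpoly int[t.+1]}).
Variables (Q : 'I_t.+1 -> 'M[R]_(n, d)) (V : 'I_t -> 'M[R]_(n, d)).
Variable s : state R.
Hypothesis s_input : att_input s Q V.
Local Notation F := (edge_logit t h R n d (mem s)).
Local Notation Z k := (partition_fun R _ _ ord0 F [set: 'I_t.+1]
    (fun i x => init_weight t R d (mem s) i x k)).

Lemma expR_edge_logit (l : {ffun 'I_t.+1 -> 'I_n}) :
  expR (2^-1 * \sum_i \sum_j F i j (l i) (l j)) = att_weight h Q l.
Proof.
have [_ _ hQ _] := s_input.
rewrite /att_weight /eval_poly2 sum_ltn_half; first last.
- by move=> i j; apply: eq_bigr => k _; rewrite mulrC.
- exact: graph_of_irr.
- exact: graph_of_sym.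
congr expR; rewrite mulrCA; congr (_ * _).
rewrite mulr_sumr; apply: eq_bigr => i _.
rewrite mulr_sumr; apply: eq_bigr => j _.
rewrite /edge_logit /logit mulrC; congr (_ * _).
case: ifP => _; last by rewrite sumr_const mul0rn.
by apply: eq_bigr => k _; rewrite !mxE !hQ.
Qed.

Lemma denominatorE a :
  Z d a = \sum_(l : {ffun 'I_t.+1 -> 'I_n} | l ord0 == a) att_weight h Q l.
Proof.
rewrite partition_fun_setT; apply: eq_bigr => l _.
rewrite expR_edge_logit big1 ?mul1r // => i _.
by rewrite /init_weight ltnn andbF.
Qed.

Lemma numeratorE (k : 'I_d) a :
  Z k a = \sum_(l : {ffun 'I_t.+1 -> 'I_n} | l ord0 == a)
    att_weight h Q l * \prod_(j < t) V j (l (lift ord0 j)) k.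
Proof.
have [_ _ _ hV] := s_input.
rewrite partition_fun_setT; apply: eq_bigr => l _.
rewrite expR_edge_logit mulrC; congr (_ * _).
(* The root contributes weight 1; the remaining vertices are [lift ord0 j]. *)
rewrite big_ord_recl /init_weight /= mul1r; apply: eq_bigr => j _.
by rewrite ltn_ord -hV /= addSnnS.
Qed.

(** All terms are exponentials, and the constant assignment shows that the sum is not empty. *)
Lemma denominator_neq0 a : Z d a != 0.
Proof.
rewrite denominatorE (bigD1 [ffun=> a]) ?ffunE //= gt_eqF //.
by rewrite ltr_wpDr ?expR_gt0 // sumr_ge0 // => l _; exact: expR_ge0.
Qed.

End AttentionValue.

(** As [n] and [d] are positive, all lower-order terms are at most [D]. Each initialisation, each
    elimination, and prologue with output together cost at most [60 * D]; the 60 is generous. *)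
Lemma att_cost_le t n d m : (0 < n)%N -> (0 < d)%N ->
  ((d * 3 + 7) + (t.+1 * ((n * ((d.+1 * 3 + 2) + 2) + 2) +
       (n * ((d * 3 + 2) + 2) + 2)) +
     (m * absorb_cost n d + (n * ((d * 3 + 2) + 2) + 2)))
   <= 60 * (t.+1 + m + 1) * (n * n * d))%N.
Proof.
move=> n0 d0; set D := (n * n * d)%N.
have n1 : (n <= n * d)%N by rewrite leq_pmulr.
have n2 : (n * d <= D)%N by rewrite /D -mulnA leq_pmull.
have n3 : (n * n <= D)%N by rewrite /D leq_pmulr.
have n4 : (d <= n * d)%N by rewrite leq_pmull.
have ha : (absorb_cost n d <= 60 * D)%N by rewrite /absorb_cost /D in n2 n3 *; nia.
have hi : ((n * ((d.+1 * 3 + 2) + 2) + 2) + (n * ((d * 3 + 2) + 2) + 2) <= 60 * D)%N.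
  by lia.
have ho : ((d * 3 + 7) + (n * ((d * 3 + 2) + 2) + 2) <= 60 * D)%N by lia.
have := leq_mul (leqnn t.+1) hi; have := leq_mul (leqnn m) ha.
move: ho; set x := absorb_cost n d; clearbody x; lia.
Qed.

Theorem theoremD2 (R : realType) (t : nat) (h : {mpoly int[t.+1]})
    (h_tree : tree_poly h) :
  exists p : prog, forall C : R, exists (K : R) (e : nat),
    forall n d : nat, (2 <= n)%N -> (1 <= d)%N -> d%:R <= C * ln n%:R ->
    forall (Q : 'I_t.+1 -> 'M[R]_(n, d)) (V : 'I_t -> 'M[R]_(n, d)),
      att_computes p Q V (Att h Q V) (K * n%:R ^+ 2 * ln n%:R ^+ e).
Proof.
have [_ _ h_acyclic] := h_tree.
(* The order, and hence the program, depends on [h] alone, so it is fixed before [C], [n], [d] and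
   the matrices. *)
have [L hL] := elim_order_exists _ _ (graph_of_sym _ h) (graph_of_irr _ h)
  h_acyclic ord0 [set: 'I_t.+1] (in_setT _).
exists (att_prog t h L) => C.
pose c := (60 * (t.+1 + size L + 1))%N.
(* The cost is at most [c n^2 d], and the bound on [d] supplies the single logarithmic factor. *)
exists (c%:R * C), 1%N => n d n2 d1 hd Q V s hs.
have n0 : (0 < n)%N by exact: ltnW.
have [h0 h1 _ _] := hs.
(* The reference memory [m0] is the initial memory itself, so agreement with it is reflexivity. *)
have [s' [T [ex hT hA]]] := att_spec t h R n d (mem s) d1 L s hL h0 h1
  (fun _ _ _ _ => erefl) (denominator_neq0 R t n d h Q V s hs).
exists s', T; split=> //.
  have /(leq_trans hT) := att_cost_le t n d (size L) n0 d1.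
  rewrite -/c -(ler_nat R) => /le_trans; apply.
  have -> : (c * (n * n * d))%:R = c%:R * n%:R * n%:R * d%:R :> R.
    by rewrite !natrM; ring.
  have -> : c%:R * C * n%:R ^+ 2 * ln n%:R ^+ 1 =
    c%:R * n%:R * n%:R * (C * ln n%:R) :> R by ring.
  by rewrite ler_wpM2l // !mulr_ge0.
move=> a k; rewrite hA mxE.
by rewrite (numeratorE R t n d h Q V s hs) (denominatorE R t n d h Q V s hs).
Qed.
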